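(* Let $A=X^*$ be a dual uniform algebra and let $(x_n)_{n\ge 1}$ be a sequence in $M_A\cap X$. For each $n$ put $\delta_n:=\prod_{k\neq n}\rho_A(x_n,x_k)$. If $\sum_{n=1}^\infty(1-\delta_n)^{1/3}<\infty$, then $(x_n)_n$ is interpolating for $A$, i.e. for every bounded sequence of complex numbers $(\alpha_n)_n$ there exists $f\in A$ such that $f(x_n)=\alpha_n$ for every $n$.
   Context: A uniform algebra $A$ is a unital commutative Banach algebra whose norm satisfies $\|f^2\|=\|f\|^2$ (equivalently, a closed unital point-separating subalgebra of some $C(K)$, $K$ compact Hausdorff, with the sup norm). $M_A\subset A^*$ denotes its maximal ideal space (the nonzero multiplicative linear functionals), and for $x\in M_A$, $f\in A$ we write $f(x):=x(f)$. A dual uniform algebra $A=X^*$ is a uniform algebra that is (isometrically) the dual of a Banach space $X$; $X$ is regarded as a subspace of $X^{**}=A^*$, so $M_A\cap X$ is the set of weak-star continuous characters of $A$. The Gleason distance on $M_A$ is $$\rho_A(x,y):=\sup\{|f(x)|: f\in A,\ \|f\|\le 1,\ f(y)=0\}.$$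
   Formalization: The points x_n are assumed pairwise distinct; with a repeated point (e.g. x_1 = x_2 = 0 in H^∞ together with a very sparse sequence) the series can converge although interpolation fails. *)

(* Defs.v *)
From HB Require Import structures.
From mathcomp Require Import all_boot all_order all_algebra.
From mathcomp Require Import complex.
From mathcomp Require Import all_classical all_reals all_analysis.

Set Implicit Arguments.
Unset Strict Implicit.
Unset Printing Implicit Defensive.

Import Order.TTheory GRing.Theory Num.Theory.
Import numFieldNormedType.Exports.

Local Open Scope classical_set_scope.
Local Open Scope ring_scope.

(* The multiplication is part of the mixin because a structure inheriting from
   both the ring and the normed hierarchies is rejected by Hierarchy-Builder
   (their only declared join is [numDomainType]). *)
HB.mixin Record isUniformAlgebra (K : numFieldType) A
    of CompleteNormedModule K A := {
  ua_mul : A -> A -> A ;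
  ua_one : A ;
  ua_mulA : associative ua_mul ;
  ua_mulC : commutative ua_mul ;
  ua_mul1 : left_id ua_one ua_mul ;
  ua_mulDl : left_distributive ua_mul +%R ;
  ua_scaleAl : forall (a : K) (f g : A),
    a *: ua_mul f g = ua_mul (a *: f) g ;
  ua_norm1 : `|ua_one| = 1 ;
  ua_normM : forall f g : A, `|ua_mul f g| <= `|f| * `|g| ;
  ua_norm_sqr : forall f : A, `|ua_mul f f| = `|f| ^+ 2
}.

#[short(type="uniformAlgType")]
HB.structure Definition UniformAlgebra (K : numFieldType) :=
  {A of isUniformAlgebra K A & CompleteNormedModule K A}.

Section Duality.
Variable K : numFieldType.

Definition dual_space (V : normedModType K) : set (V -> K) :=
  [set phi : V -> K | scalar phi /\ continuous phi].

Definition maximal_ideal_space (A : uniformAlgType K) : set (A -> K) :=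
  [set x : A -> K | [/\ dual_space x,
               forall f g : A, x (ua_mul f g) = x f * x g &
               exists f : A, x f != 0]].

End Duality.

Section DualUniformAlgebra.
Variable R : realType.
Local Notation C := R[i].
Local Notation normc := ComplexField.Normc.normc.

Definition dual_norm (V : normedModType C) (phi : V -> C) : R :=
  sup [set normc (phi v) | v in [set v : V | `|v| <= 1]].

(* [J] is an isometric linear isomorphism of [A] onto the Banach dual of [X];
   the norm of [A] takes its values in [C], hence the injection [%:C]. *)
Definition isometric_dual (A : uniformAlgType C) (X : completeNormedModType C)
    (J : A -> X -> C) : Prop :=
  [/\ forall (a : C) (f g : A) (v : X), J (a *: f + g) v = a * J f v + J g v,
      range J = @dual_space C X &
      forall f : A, `|f| = (dual_norm (J f))%:C%C].

(* The copy of [X] inside [X^** = A^*]. *)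
Definition canonical_image (A : uniformAlgType C) (X : completeNormedModType C)
    (J : A -> X -> C) : set (A -> C) :=
  range (fun (v : X) (f : A) => J f v).

Definition gleason_dist (A : uniformAlgType C) (x y : A -> C) : R :=
  sup [set normc (x f) | f in [set f : A | `|f| <= 1 /\ y f = 0]].

(* Infinite product, as the limit of the partial products; for points of the
   maximal ideal space these are nonincreasing in [0, 1]. *)
Definition gleason_prod (A : uniformAlgType C) (x : nat -> A -> C) (n : nat) : R :=
  limn (fun N => \prod_(0 <= k < N | k != n) gleason_dist (x n) (x k)).

Definition interpolating (A : uniformAlgType C) (x : nat -> A -> C) : Prop :=
  forall alpha : nat -> C,
    (exists M : R, forall n, normc (alpha n) <= M) ->
    exists f : A, forall n, x n f = alpha n.

End DualUniformAlgebra.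

(* Main.v *)
(** It is enough to interpolate at the first [N] points by functions of norm at
   most a constant independent of [N]: the points being weak-star continuous, an
   ultrafilter limit of these functions in [A = X^*] interpolates everywhere.

   Near-extremal functions for the Gleason distances multiply to functions [g_n]
   of norm at most 1 with [g_n(x_n) = a_n] close to [delta_n], vanishing at the
   other points. A Blaschke factor with zero [a_n] turns [g_n] into [v_n] with
   [v_n(x_n) = 0] and [v_n(x_k) = c_n < a_n] for [k <> n]. With
   [h_n = (1 - v_n) / 2] and [u_n = (1 + v_n) / 2], for which
   [|h_n|^2 + |u_n|^2 <= 1], the sum over [n] of [t_n g_n h_n^2] times the product
   of the [u_k^2], [k < n], has norm at most [sup |t_n|], and its value at [x_n] is
   [t_n (a_n / 4)] times the product of the [((1 + c_k) / 2)^2], [k < n]. This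
   product is bounded below as soon as the [1 - delta_n] are summable and every
   [delta_n] is positive; the latter follows from the symmetry of the Gleason
   distance.

   Norms are estimated without the Gelfand transform: if [|p| <= 1] on the unit
   circle and [|g| <= 1], the coefficients of [p^m] have modulus at most 1, so the
   norm of [p(g)^m] grows at most linearly in [m], whereas
   [|p(g)^(2^k)| = |p(g)|^(2^k)]. *)
Require Import Defs.
From HB Require Import structures.
From mathcomp Require Import all_boot all_order all_algebra.
From mathcomp Require Import cyclic separable cyclotomic ring lra complex.
From mathcomp Require Import all_classical all_reals all_analysis.

Set Implicit Arguments.
Unset Strict Implicit.
Unset Printing Implicit Defensive.

Import Order.TTheory GRing.Theory Num.Theory.
Import numFieldNormedType.Exports.

Local Open Scope classical_set_scope.
Local Open Scope ring_scope.

Local Notation normc := ComplexField.Normc.normc.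

(** * Coefficients of polynomials bounded on the unit circle *)

Section UnitCircle.
Variable C : numClosedFieldType.

(** In characteristic 0 the polynomial ['X^n - 1] is separable, so its [n] roots are distinct. *)
Lemma prim_root_exists (n : nat) : (0 < n)%N -> exists z : C, n.-primitive_root z.
Proof.
move=> n_gt0; have [r] := closed_field_poly_normal ('X^n - 1 : {poly C}).
rewrite (monicP _) ?monicXnsubC // scale1r => Dr.
have n_neq0 : n%:R != 0 :> C by rewrite pnatr_eq0 -lt0n.
have /hasP[z _ ?] : has n.-primitive_root r; last by exists z.
apply: has_prim_root => //.
- by apply/allP => z zr; rewrite /root_of_unity Dr root_prod_XsubC.
- by rewrite -separable_prod_XsubC -Dr separable_Xn_sub_1.
- by rewrite -ltnS -(size_prod_XsubC r id) -Dr size_XnsubC.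
Qed.

Lemma sum_prim_root_exp (n k : nat) (w : C) : n.-primitive_root w ->
  \sum_(i < n) w ^+ (i * k) = if (n %| k)%N then n%:R else 0.
Proof.
move=> wn; have E i : w ^+ (i * k) = (w ^+ k) ^+ i by rewrite mulnC exprM.
under eq_bigr do rewrite E.
case: ifPn => [/dvdnP[m ->]|nk].
  rewrite mulnC exprM (prim_expr_order wn).
  rewrite (eq_bigr (fun=> 1)) => [|i _]; last by rewrite !expr1n.
  by rewrite sumr_const card_ord.
apply/eqP; have : (w ^+ k - 1) * \sum_(i < n) (w ^+ k) ^+ i == 0.
  by rewrite -subrX1 -exprM mulnC exprM (prim_expr_order wn) expr1n subrr.
by rewrite mulf_eq0 subr_eq0 -(prim_order_dvd wn) (negPf nk).
Qed.

(** Discrete Fourier inversion at the [n]-th roots of unity, with [n] the size of [p] so that no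
    aliasing occurs; [w ^+ (i * (n - j))] is the conjugate of [w ^+ (i * j)]. *)
Lemma norm_coef_le1 (p : {poly C}) (j : nat) :
  (forall z : C, `|z| = 1 -> `|p.[z]| <= 1) -> `|p`_j| <= 1.
Proof.
move=> pb; have [jp|pj] := ltnP j (size p); last by rewrite nth_default// normr0.
set n := size p; have n_gt0 : (0 < n)%N by rewrite (leq_trans _ jp).
have [w wn] := prim_root_exists n_gt0.
have w1 i : `|w ^+ i| = 1.
  apply/eqP; rewrite -(@pexpr_eq1 _ _ n)// -normrX -exprM mulnC exprM.
  by rewrite (prim_expr_order wn) expr1n normr1.
have S : \sum_(i < n) p.[w ^+ i] * w ^+ (i * (n - j)) = n%:R * p`_j.
  under eq_bigr => i _.
    rewrite horner_coef mulr_suml.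
    under eq_bigr => l _ do rewrite -mulrA -exprM -exprD -mulnDr.
    over.
  rewrite exchange_big/=.
  under eq_bigr => l _ do rewrite -mulr_sumr sum_prim_root_exp//.
  rewrite (bigD1 (Ordinal jp))//= subnKC ?(ltnW jp)// dvdnn mulrC.
  (* Since [0 < l + (n - j) < 2n], divisibility by [n] forces [l = j]. *)
  rewrite big1 ?addr0// => l lj; case: ifPn; rewrite ?mulr0// => /dvdnP[q Eq].
  suff /eqP : l = j :> nat by move: lj; rewrite -val_eqE/= => /negPf->.
  have := ltn_ord l; move: Eq; case: q => [|[|q]]; rewrite ?mul1n.
  - by move=> /eqP; rewrite mul0n addn_eq0 subn_eq0 leqNgt jp andbF.
  - move=> E _; apply/eqP; rewrite -(eqn_add2r (n - j)) E subnKC// ltnW//.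
  - move=> E ln; have : (l + (n - j) < n + n)%N by rewrite -addSn leq_add// leq_subr.
    by rewrite E ltnNge addnn -mul2n leq_mul2r orbT.
have n0 : 0 < n%:R :> C by rewrite ltr0n.
rewrite -(ler_pM2l n0) mulr1 -[X in X * _]ger0_norm ?ler0n// -normrM -S.
apply: le_trans (ler_norm_sum _ _ _) _.
have -> : n%:R = \sum_(i < n) 1 :> C by rewrite sumr_const card_ord.
apply: ler_sum => i _.
by rewrite normrM w1 mulr1 pb.
Qed.
End UnitCircle.

(** For [t > 1], Bernoulli's inequality only matches the allowed linear growth in [2 ^ k]; its
    square, at exponent [2 ^ k.+1], beats it. *)
Lemma le1_of_expr_2exp (R : archiRealFieldType) (c t : R) : 0 <= t ->
  (forall k, t ^+ (2 ^ k) <= c * 2 ^+ k) -> t <= 1.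
Proof.
move=> t0 H; rewrite leNgt; apply/negP => t1.
set s := t - 1; have s0 : 0 < s by rewrite subr_gt0.
have bern n : n%:R * s <= t ^+ n.
  elim: n => [|n IH]; first by rewrite mul0r exprn_ge0.
  have -> : t ^+ n.+1 = t ^+ n * s + t ^+ n by rewrite exprSr mulrBr mulr1 subrK.
  rewrite -natr1 mulrDl mul1r addrC lerD// ler_peMl ?(ltW s0)//.
  by rewrite exprn_ege1// ltW.
have key k : 2 ^+ k <= c * 2 / s ^+ 2.
  rewrite ler_pdivlMr ?exprn_gt0//.
  have p2 : 0 < 2 ^+ k :> R by rewrite exprn_gt0.
  rewrite -(ler_pM2l p2).
  have -> : 2 ^+ k * (2 ^+ k * s ^+ 2) = ((2 ^ k)%:R * s) ^+ 2.
    by rewrite natrX [RHS]exprMn !expr2 !mulrA.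
  have -> : 2 ^+ k * (c * 2) = c * 2 ^+ k.+1 by rewrite exprSr mulrCA mulrA.
  apply: le_trans (H k.+1); rewrite expnSr exprM lerXn2r// nnegrE.
    by rewrite mulr_ge0// ltW.
  by rewrite exprn_ge0.
set B := c * 2 / s ^+ 2 in key.
have B0 : 0 <= B by apply: le_trans (key 0%N); rewrite expr0.
have Bm := archi_boundP B0; set m := Num.bound B in Bm.
have := key m; apply/negP; rewrite -ltNge (lt_le_trans Bm)//.
by rewrite -natrX ler_nat ltnW// ltn_expl.
Qed.

(* [ua_mul] cannot be the product of a ring structure on [A] itself, so the copy
   [ua_ring A] carries the [comAlgType] structure, and [ua_norm] the norm. *)
Definition ua_ring (K : numFieldType) (A : uniformAlgType K) : Type := A.

(** * The algebra as a ring, and elementary norm inequalities *)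

Section UaRing.
Variables (K : numFieldType) (A : uniformAlgType K).

Definition ua_norm (f : ua_ring A) : K := `|f : A|.

HB.instance Definition _ := GRing.Lmodule.copy (ua_ring A) A.

Let one_neq0 : (@ua_one K A : ua_ring A) != 0.
Proof.
apply/eqP => e; have := @ua_norm1 K A; rewrite [ua_one]e normr0 => /eqP.
by rewrite eq_sym oner_eq0.
Qed.

HB.instance Definition _ := GRing.Zmodule_isComNzRing.Build (ua_ring A)
  (@ua_mulA K A) (@ua_mulC K A) (@ua_mul1 K A) (@ua_mulDl K A) one_neq0.
HB.instance Definition _ :=
  GRing.Lmodule_isLalgebra.Build K (ua_ring A) (@ua_scaleAl K A).
HB.instance Definition _ := GRing.Lalgebra_isComAlgebra.Build K (ua_ring A).

Implicit Types f g : ua_ring A.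

Lemma ua_norm_ge0 f : 0 <= ua_norm f. Proof. exact: normr_ge0. Qed.

Lemma ua_normD f g : ua_norm (f + g) <= ua_norm f + ua_norm g.
Proof. exact: (@ler_normD _ A). Qed.

Lemma ua_norm0 : ua_norm 0 = 0. Proof. exact: (@normr0 _ A). Qed.

Lemma ua_normZ (a : K) f : ua_norm (a *: f) = `|a| * ua_norm f.
Proof. exact: (@normrZ _ A). Qed.

Lemma ua_normM_le f g : ua_norm (f * g) <= ua_norm f * ua_norm g.
Proof. exact: (@ua_normM K A). Qed.

Lemma ua_normX_le f n : ua_norm (f ^+ n) <= ua_norm f ^+ n.
Proof.
elim: n => [|n IH]; first by rewrite !expr0 [leLHS]ua_norm1.
by rewrite !exprS (le_trans (ua_normM_le _ _))// ler_wpM2l// ua_norm_ge0.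
Qed.

Lemma ua_normX2k f k : ua_norm (f ^+ (2 ^ k)) = ua_norm f ^+ (2 ^ k).
Proof.
elim: k => [|k IH]; first by rewrite !expr1.
by rewrite expnSr !exprM -IH expr2 [LHS]ua_norm_sqr.
Qed.

Lemma ua_norm_sum (I : Type) (r : seq I) (F : I -> ua_ring A) :
  ua_norm (\sum_(i <- r) F i) <= \sum_(i <- r) ua_norm (F i).
Proof.
elim/big_ind2 : _ => //; first by rewrite ua_norm0.
by move=> ? ? ? ? H1 H2; rewrite (le_trans (ua_normD _ _))// lerD.
Qed.

Lemma ua_normM_le1 f g : ua_norm f <= 1 -> ua_norm g <= 1 -> ua_norm (f * g) <= 1.
Proof.
by move=> f1 g1; rewrite (le_trans (ua_normM_le _ _))// mulr_ile1 ?ua_norm_ge0.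
Qed.

Lemma ua_normX_le1 f n : ua_norm f <= 1 -> ua_norm (f ^+ n) <= 1.
Proof.
by move=> f1; rewrite (le_trans (ua_normX_le _ _))// exprn_ile1 ?ua_norm_ge0.
Qed.

Lemma horner_algE f (p : {poly K}) :
  horner_alg f p = \sum_(i < size p) p`_i *: f ^+ i.
Proof.
rewrite /horner_alg/horner_morph horner_coef size_map_poly.
by apply: eq_bigr => i _; rewrite coef_map/= mulr_algl.
Qed.

End UaRing.

(** * Polynomials evaluated at elements of norm at most 1 *)

Section VonNeumann.
Variables (R : realType) (A : uniformAlgType R[i]).
Local Notation C := R[i].
Implicit Types f g v : ua_ring A.

Lemma ua_norm_le1 f (c : nat) :
  (forall k, ua_norm (f ^+ (2 ^ k)) <= (c * 2 ^ k)%:R) -> ua_norm f <= 1.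
Proof.
move=> H; set t := complex.Re (ua_norm f).
have ft : ua_norm f = t%:C%C.
  by rewrite /t RRe_real// ger0_real// ua_norm_ge0.
rewrite ft -[1]/((1 : R)%:C%C) lecR; apply: (@le1_of_expr_2exp R c%:R).
  by rewrite -lecR -ft ua_norm_ge0.
move=> k; rewrite -lecR (rmorphXn (real_complex R))/= -ft -ua_normX2k (le_trans (H k))//.
rewrite (rmorphM (real_complex R)) (rmorphXn (real_complex R)).
by rewrite !(rmorph_nat (real_complex R)) natrM natrX.
Qed.

(** The coefficients of [p ^+ (2 ^ k)] have modulus at most 1, and there are at most
    [(size p).-1 * 2 ^ k + 1] of them; the extra unit is absorbed by the constant [(size p).+1]. *)
Lemma von_neumann g (p : {poly C}) : ua_norm g <= 1 ->
  (forall z : C, `|z| = 1 -> `|p.[z]| <= 1) -> ua_norm (horner_alg g p) <= 1.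
Proof.
move=> g1 p1; apply: (@ua_norm_le1 _ (size p).+1) => k.
rewrite -rmorphXn/= horner_algE.
apply: (@le_trans _ _ (size (p ^+ (2 ^ k)))%:R).
  rewrite -[in leRHS](card_ord (size (p ^+ (2 ^ k)))) -sumr_const.
  apply: le_trans (ua_norm_sum _ _) _.
  apply: ler_sum => i _; rewrite ua_normZ mulr_ile1 ?ua_norm_ge0 ?ua_normX_le1//.
  by apply: norm_coef_le1 => z z1; rewrite horner_exp normrX exprn_ile1 ?p1.
rewrite ler_nat (leq_trans (size_poly_exp_leq _ _))// mulSn -add1n leq_add ?expn_gt0//.
by rewrite leq_mul2r leq_pred orbT.
Qed.

(** With [m = 2 ^ k], the [m]-th power has [m + 1] binomial terms. Each is a polynomial in [v] times
    powers of [f] and [g], and on the circle the modulus of that polynomial is a single term of the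
    expansion of [(|ph|^2 + |pu|^2)^m = 1]. *)
Lemma peak_combination v f g :
  ua_norm v <= 1 -> ua_norm f <= 1 -> ua_norm g <= 1 ->
  ua_norm ((2^-1 *: (1 - v)) ^+ 2 * f + (2^-1 *: (1 + v)) ^+ 2 * g) <= 1.
Proof.
move=> v1 f1 g1; set h := 2^-1 *: (1 - v); set u := 2^-1 *: (1 + v).
pose ph : {poly C} := 2^-1 *: (1 - 'X); pose pu : {poly C} := 2^-1 *: (1 + 'X).
have hE : h = horner_alg v ph.
  by rewrite /ph linearZ/= rmorphB rmorph1 [X in 1 - X](horner_algX v) mulr_algl.
have uE : u = horner_alg v pu.
  by rewrite /pu linearZ/= rmorphD rmorph1 [X in 1 + X](horner_algX v) mulr_algl.
apply: (@ua_norm_le1 _ 2) => k; set m := (2 ^ k)%N; rewrite exprDn.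
set T := (X in ua_norm (\sum_(i < _) X i)).
apply: (@le_trans _ _ (m.+1)%:R); last first.
  by rewrite ler_nat mul2n -addnn -addn1 leq_add2l expn_gt0.
have -> : m.+1%:R = \sum_(i < m.+1) 1 :> C by rewrite sumr_const card_ord.
apply: (le_trans (ua_norm_sum _ _)); apply: ler_sum => i _.
pose p := (ph ^+ 2) ^+ (m - i) * (pu ^+ 2) ^+ i *+ 'C(m, i).
have -> : T i = horner_alg v p * (f ^+ (m - i) * g ^+ i).
  rewrite /T /p rmorphMn rmorphM !rmorphXn/= -hE -uE !exprMn mulrnAl.
  by rewrite mulrACA.
apply: ua_normM_le1; last by apply: ua_normM_le1; apply: ua_normX_le1.
apply: von_neumann => // z z1.
have zz : z * z^* = 1 by rewrite -normCK z1 expr1n.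
have S : `|ph.[z]| ^+ 2 + `|pu.[z]| ^+ 2 = 1.
  rewrite !normCK /ph /pu !hornerE !rmorphM/= !rmorphD !rmorphN/= !rmorph1 fmorphV/=.
  rewrite conjC_nat.
  have -> : 2^-1 * (1 - z) * (2^-1 * (1 - z^*)) +
      2^-1 * (1 + z) * (2^-1 * (1 + z^*)) = 2^-1 * (1 + z * z^*) by field.
  by rewrite zz; field.
rewrite /p hornerMn hornerM !horner_exp normrMn normrM !normrX.
rewrite -[leRHS](expr1n _ m) -S exprDn (bigD1 i)//=.
rewrite lerDl sumr_ge0// => j _.

Qed.

(* A truncation of the Blaschke factor [(a - z) / (1 - a z)]. *)
Lemma truncated_blaschke (a b : R) : 0 < b -> b < a -> a < 1 ->
  exists p : {poly C}, [/\ forall z, `|z| = 1 -> `|p.[z]| <= 1,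
    p.[0] = b%:C%C & p.[a%:C%C] = 0].
Proof.
move=> b0 ba a1; have a0 : 0 < a by exact: lt_trans ba.
(* The gap [b < a] pays for the truncation: this gives [(b / a) * (1 + a ^+ n.+1) <= 1]. *)
have [n an] : exists n, a ^+ n <= a / b - 1.
  have e0 : 0 < a / b - 1 by rewrite subr_gt0 ltr_pdivlMr// mul1r.
  have := @cvg_expr _ a; rewrite ger0_norm ?ltW// => /(_ a1).
  move=> /cvgrPdist_lt/(_ _ e0)[n _ /(_ n (leqnn n))]/=.
  rewrite sub0r normrN => H; exists n; exact: (le_trans (ler_norm _) (ltW H)).
exists ((b / a)%:C%C *: ((a%:C%C)%:P - 'X) *
   \sum_(k < n.+1) ((a%:C%C) *: 'X) ^+ k); split.
- move=> z z1; set w := a%:C%C * z.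
  rewrite hornerM hornerZ hornerD hornerN hornerC hornerX horner_sum.
  under eq_bigr do rewrite horner_exp hornerZ hornerX -/w.
  have zz : z * z^* = 1 by rewrite -normCK z1 expr1n.
  have aC : (a%:C%C)^* = a%:C%C :> C by rewrite conj_Creal// ger0_real// lecR ltW.
  (* As [|a - z| = |1 - a z|] on the circle, the geometric sum telescopes up to modulus. *)
  have -> : `|(b / a)%:C%C * (a%:C%C - z) * \sum_(i < n.+1) w ^+ i| =
      (b / a)%:C%C * `|w ^+ n.+1 - 1|.
    rewrite subrX1 !normrM mulrA; congr (_ * _ * _).
      by rewrite ger0_norm// lecR divr_ge0// ltW.
    apply/eqP; rewrite -(@eqrXn2 _ 2)// !normCK /w !rmorphB !rmorphM/= rmorph1 aC.
    apply/eqP/subr0_eq.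
    have -> : (a%:C%C - z) * (a%:C%C - z^*) - (a%:C%C * z - 1) * (a%:C%C * z^* - 1) =
        (a%:C%C ^+ 2 - 1) * (1 - z * z^*) by ring.
    by rewrite zz subrr mulr0.
  rewrite (@le_trans _ _ ((b / a)%:C%C * (a ^+ n.+1 + 1)%:C%C))//.
    apply: ler_wpM2l; first by rewrite lecR divr_ge0// ltW.
    apply: (le_trans (ler_normB _ _)).
    rewrite normr1 (rmorphD (real_complex R)) (rmorph1 (real_complex R)) lerD2r.
    by rewrite normrX normrM z1 mulr1 (rmorphXn (real_complex R)) ger0_norm// lecR ltW.
  rewrite -(rmorphM (real_complex R)) -[leRHS]/((1 : R)%:C%C) lecR mulrC -ler_pdivlMr ?divr_gt0//.
  rewrite mul1r invf_div -lerBrDr (le_trans _ an)// exprSr ler_piMr ?exprn_ge0//; exact: ltW.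
- rewrite hornerM hornerZ hornerD hornerN hornerC hornerX subr0 horner_sum.
  rewrite big_ord_recl/= expr0 hornerC big1 => [|i _]; last first.
    by rewrite horner_exp hornerZ hornerX mulr0 expr0n.
  by rewrite addr0 mulr1 -(rmorphM (real_complex R))/= divfK// gt_eqF.
- by rewrite hornerM hornerZ hornerD hornerN hornerC hornerX subrr mulr0 mul0r.
Qed.

End VonNeumann.

(** * Complex moduli as real numbers; boundedness of functionals *)

Section NormC.
Variable R : realType.

Lemma norm_normc (z : R[i]) : `|z| = (normc z)%:C%C.
Proof. by case: z => a b; rewrite normc_def. Qed.

Lemma normc_ge0 (z : R[i]) : 0 <= normc z.
Proof. by case: z => a b; exact: sqrtr_ge0. Qed.

Lemma normc_real (a : R) : normc a%:C%C = `|a|.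
Proof. by rewrite /= expr0n/= addr0 sqrtr_sqr. Qed.

Lemma dual_space_bounded (V : normedModType R[i]) (phi : V -> R[i]) :
  dual_space phi -> exists M : R, forall v, `|v| <= 1 -> normc (phi v) <= M.
Proof.
move=> [lin /(_ 0) cont].
have phi0 : phi 0 = 0.
  by have := lin (-1) 0 0; rewrite scaler0 addr0 mulN1r addNr.
have phiZ (a : R[i]) v : phi (a *: v) = a * phi v.
  by have := lin a v 0; rewrite addr0 phi0 addr0.
have /(cvgr_dist_lt _ _)/(_ 1 ltr01)/nbhs_normP[e/= e0 H] := cont.
(* The radius [e] lives in [R[i]]; [normc] turns the bound [2 / e] into a real number. *)
exists (normc (2 / e)) => v v1; rewrite -lecR -!norm_normc.
have e2 : 0 < e / 2 by rewrite divr_gt0.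
have ev : e / 2 * `|v| < e.
  apply: (@le_lt_trans _ _ (e / 2)); first by rewrite ler_piMr// ltW.
  by rewrite ltr_pdivrMr// ltr_pMr// ltr1n.
have := H ((e / 2) *: v).
rewrite /ball_/= sub0r normrN normrZ (gtr0_norm e2) => /(_ ev)/ltW.
rewrite phi0 sub0r normrN phiZ normrM (gtr0_norm e2) -ler_pdivlMl// mulr1 invf_div.
move=> /le_trans; apply.
by rewrite ger0_norm// divr_ge0// ltW.
Qed.

End NormC.

(** * Characters, the Gleason distance and finite interpolation *)

Section Characters.
Variables (R : realType) (A : uniformAlgType R[i]).
Local Notation C := R[i].
Implicit Types (f g v : ua_ring A) (x y : A -> C).
Local Notation M_A := (@maximal_ideal_space C A).

Lemma charP x : M_A x -> forall (a : C) f g, x (a *: f + g) = a * x f + x g.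
Proof. by case=> -[]. Qed.

Lemma charM x : M_A x -> forall f g, x (f * g) = x f * x g.
Proof. by case. Qed.

Lemma char1 x : M_A x -> x (1 : ua_ring A) = 1.
Proof.
move=> Hx; have [_ _ [f xf0]] := Hx.
by apply: (mulIf xf0); rewrite mul1r -(charM Hx) mul1r.
Qed.

Lemma char0 x : M_A x -> x (0 : ua_ring A) = 0.
Proof. by move=> /charP/(_ (-1) 0 0); rewrite scaler0 addr0 mulN1r addNr. Qed.

Lemma charZ x : M_A x -> forall (a : C) f, x (a *: f) = a * x f.
Proof. by move=> Hx a f; have := charP Hx a f 0; rewrite addr0 char0// addr0. Qed.

Lemma charD x : M_A x -> forall f g, x (f + g) = x f + x g.
Proof. by move=> Hx f g; have := charP Hx 1 f g; rewrite scale1r mul1r. Qed.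

Lemma charN x : M_A x -> forall f, x (- f) = - x f.
Proof. by move=> Hx f; rewrite -scaleN1r charZ// mulN1r. Qed.

Lemma charX x : M_A x -> forall f n, x (f ^+ n) = x f ^+ n.
Proof.
move=> Hx f; elim=> [|n IH]; first by rewrite !expr0 char1.
by rewrite !exprS charM// IH.
Qed.

Lemma char_horner x : M_A x -> forall f p, x (horner_alg f p) = p.[x f].
Proof.
move=> Hx f p; rewrite horner_algE horner_coef.
elim: (size p) => [|n IH]; first by rewrite !big_ord0 char0.
by rewrite !big_ord_recr/= charD// IH charZ// charX.
Qed.

(** The powers of [f] stay in the unit ball, where the continuous [x] is bounded, so the powers of
    [|x f|] are bounded. *)
Lemma char_le1 x f : M_A x -> ua_norm f <= 1 -> normc (x f) <= 1.
Proof.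
move=> Hx f1; have [/dual_space_bounded[M HM] _ _] := Hx.
have M0 : 0 <= M by apply: le_trans (HM 0 _); rewrite ?normc_ge0// normr0.
apply: (@le1_of_expr_2exp R M); first exact: normc_ge0.
move=> k; have := HM (f ^+ (2 ^ k) : ua_ring A) (ua_normX_le1 _ f1).
rewrite charX// => H.
apply: (@le_trans _ _ M); last by rewrite ler_peMr// exprn_ege1// ler1n.
by move: H; rewrite -!lecR -norm_normc normrX norm_normc (rmorphXn (real_complex R)).
Qed.

Local Notation rho := (@gleason_dist R A).

Let gset x y : set R := [set normc (x f) | f in [set f : A | `|f| <= 1 /\ y f = 0]].

Let gset0 x y : M_A x -> M_A y -> gset x y 0.
Proof. by move=> Hx Hy; exists 0; rewrite /= ?normr0 ?char0// ComplexField.Normc.normc0. Qed.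

Let gset1 x y : M_A x -> ubound (gset x y) 1.
Proof. by move=> Hx _ [f [f1 _] <-]; exact: char_le1. Qed.

Lemma gleason_dist_ge x y f : M_A x -> ua_norm f <= 1 -> y f = 0 ->
  normc (x f) <= rho x y.
Proof.
move=> Hx f1 f0; apply: ub_le_sup; last by exists f.
by exists 1; exact: gset1.
Qed.

Lemma gleason_dist_ge0 x y : M_A x -> M_A y -> 0 <= rho x y.
Proof.
move=> Hx Hy; apply: ub_le_sup; last exact: gset0.
by exists 1; exact: gset1.
Qed.

Lemma gleason_dist_le1 x y : M_A x -> M_A y -> rho x y <= 1.
Proof.
by move=> Hx Hy; apply: ge_sup; [exists 0; exact: gset0|exact: gset1].
Qed.

(** A near-extremal function is rotated and shrunk until its value is exactly [c]. *)
Lemma gleason_dist_gt x y (c : R) : M_A x -> M_A y -> 0 <= c -> c < rho x y ->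
  exists f, [/\ ua_norm f <= 1, y f = 0 & x f = c%:C%C].
Proof.
move=> Hx Hy c0 /sup_gt[|_ [f [f1 yf] <-] cf]; first by exists 0; exact: gset0.
have nf0 : 0 < normc (x f) by exact: le_lt_trans cf.
have xf0 : x f != 0 by apply: contraTneq nf0 => ->; rewrite ComplexField.Normc.normc0 ltxx.
exists ((c%:C%C / x f) *: (f : ua_ring A)); split.
- rewrite ua_normZ mulr_ile1 ?ua_norm_ge0//.
  rewrite normrM normfV !norm_normc normc_real ger0_norm// ler_pdivrMr ?ltcR// mul1r lecR.
  exact: ltW.
- by rewrite charZ// [y _]yf mulr0.
- by rewrite charZ// divfK.
Qed.

(** If [rho y x < b < a < rho x y], take [f] with [f(y) = 0] and [f(x) = a]. For a truncated
    Blaschke factor [p], the function [p(f)] vanishes at [x] and equals [b] at [y], contradicting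
    [rho y x < b]. *)
Lemma gleason_dist_sym_le x y : M_A x -> M_A y -> rho x y <= rho y x.
Proof.
move=> Hx Hy; rewrite leNgt; apply/negP => lt_yx.
have ge0 := gleason_dist_ge0 Hy Hx; have le1 := gleason_dist_le1 Hx Hy.
pose a := (rho y x + 2 * rho x y) / 3; pose b := (2 * rho y x + rho x y) / 3.
have b0 : 0 < b by rewrite /b; lra.
have ba : b < a by rewrite /b /a; lra.
have a1 : a < 1 by rewrite /a; lra.
have [|f [f1 yf xf]] := @gleason_dist_gt x y a Hx Hy (ltW (lt_trans b0 ba)).
  by rewrite /a; lra.
have [p [p1 p0 pa]] := truncated_blaschke b0 ba a1.
have := @gleason_dist_ge y x _ Hy (von_neumann f1 p1).
rewrite (char_horner Hx) (char_horner Hy) yf xf p0 pa => /(_ erefl).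
by rewrite normc_real gtr0_norm// /b; lra.
Qed.

Lemma gleason_dist_gt0 x y : M_A x -> M_A y -> x <> y -> 0 < rho x y.
Proof.
move=> Hx Hy xy.
have [f xyf] : exists f : ua_ring A, x f != y f.
  by apply: contrapT => /forallNP H; apply: xy; apply/funext => f; apply/eqP/negPn/negP.
pose g : ua_ring A := f - (y f)%:A.
have yg : y g = 0 by rewrite /g charD// charN// charZ// char1// mulr1 subrr.
have xg : x g != 0 by rewrite /g charD// charN// charZ// char1// mulr1 subr_eq0.
have g0 : 0 < ua_norm g.
  rewrite lt_def ua_norm_ge0 andbT; apply: contra xg => /eqP/(@normr0_eq0 _ A) ->.
  by rewrite char0.
pose h := (ua_norm g)^-1 *: g.
have h1 : ua_norm h <= 1 by rewrite ua_normZ normfV gtr0_norm// mulVf// gt_eqF.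
have := @gleason_dist_ge x y h Hx h1; rewrite /h !charZ// yg mulr0 => /(_ erefl).
apply: lt_le_trans; rewrite -ltcR -norm_normc normr_gt0 mulf_neq0// invr_eq0 gt_eqF//.
Qed.

Lemma prod_gleason_dist_gt (X : nat -> A -> C) x (s : seq nat) (c : R) :
  M_A x -> (forall k, M_A (X k)) ->
  0 <= c -> c < \prod_(k <- s) rho x (X k) ->
  exists f, [/\ ua_norm f <= 1, x f = c%:C%C & forall k, k \in s -> X k f = 0].
Proof.
move=> Hx HX; elim: s c => [|k s IH] c c0.
  rewrite big_nil => c1; exists (c%:C%C%:A); split=> //.
    by rewrite ua_normZ [ua_norm _]ua_norm1 mulr1 ger0_norm ?lecR// ltW.
  by rewrite charZ// char1// mulr1.
rewrite big_cons; set P := \prod_(_ <- _) _ => cP.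
have P0 : 0 <= P by apply: prodr_ge0 => j _; exact: gleason_dist_ge0.
have P_gt0 : 0 < P.
  rewrite lt_def P0 andbT; apply: contraTneq cP => ->.
  by rewrite mulr0 -leNgt.
have cPr : c / P < rho x (X k) by rewrite ltr_pdivrMr.
(* Any value strictly between [c / P] and the distance leaves [c / c1 < P] for the remaining
   points. *)
pose c1 := (c / P + rho x (X k)) / 2.
have cP0 : 0 <= c / P by rewrite divr_ge0.
have c1cP : c / P < c1 by rewrite /c1; lra.
have c1_gt0 : 0 < c1 by lra.
have [|f [f1 kf xf]] := @gleason_dist_gt x (X k) c1 Hx (HX k) (ltW c1_gt0).
  by rewrite /c1; lra.
have [||g [g1 xg sg]] := IH (c / c1); first by rewrite divr_ge0// ltW.
  by rewrite ltr_pdivrMr// mulrC -ltr_pdivrMr.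
exists (f * g); split; first exact: ua_normM_le1.
  by rewrite charM// xf xg -(rmorphM (real_complex R)) mulrC divfK// gt_eqF.
move=> j; rewrite inE charM// => /orP[/eqP->|/sg->]; last by rewrite mulr0.
by rewrite kf mul0r.
Qed.

(* The functions [h = (1 - v) / 2] and [u = (1 + v) / 2] satisfy
   [|h|^2 + |u|^2 <= 1], so the interpolating function is assembled one point at
   a time as [h_n^2 G + u_n^2 F] at no cost in norm: [u_n] is close to 1 at the
   other points. *)
Lemma finite_interpolation (X : nat -> A -> C) (N : nat) (g v : nat -> ua_ring A)
    (a c : nat -> R) :
  (forall k, M_A (X k)) ->
  (forall n, [/\ 0 < c n, c n <= a n & c n <= 1]) ->
  (forall n, (n < N)%N -> ua_norm (g n) <= 1 /\ ua_norm (v n) <= 1) ->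
  (forall n, (n < N)%N -> X n (g n) = (a n)%:C%C /\ X n (v n) = 0) ->
  (forall n j, (n < N)%N -> (j < N)%N -> j != n ->
    X j (g n) = 0 /\ X j (v n) = (c n)%:C%C) ->
  forall (s : seq nat) (t : nat -> C), uniq s -> all (fun n => n < N)%N s ->
  (forall k, normc (t k) <= 4^-1 * \prod_(l <- s) c l ^+ 2) ->
  exists F : ua_ring A, ua_norm F <= 1 /\
    forall j, (j < N)%N -> X j F = if j \in s then t j else 0.
Proof.
move=> HX cac gv1 dgv odgv; elim=> [|n s IH] t.
  by move=> _ _ _; exists 0; rewrite ua_norm0; split=> // j _; rewrite in_nil char0.
move=> /=/andP[ns us] /andP[nN sN]; rewrite big_cons; set P := \prod_(_ <- _) _ => tb.
have [c0 ca c1] := cac n; have [g1 v1] := gv1 n nN; have [gn vn] := dgv n nN.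
have P0 : 0 <= P by apply: prodr_ge0 => l _; exact: sqr_ge0.
have P1 : P <= 1.
  by apply: prodr_ile1 => l _; have [? ? ?] := cac l; rewrite sqr_ge0 expr_le1// ltW.
pose q := (1 + c n) / 2.
have q0 : 0 < q by rewrite /q; lra.
have qC0 : q%:C%C != 0 :> C by rewrite gt_eqF// ltcR.
have cq : c n <= q by rewrite /q; lra.
(* At the other points [u_n^2] equals [q ^+ 2], so the targets are divided by it beforehand; the
   bound survives because [c n <= q]. *)
have [k|F [F1 HF]] := IH (fun k => t k / (q ^+ 2)%:C%C) us sN.
  rewrite ComplexField.Normc.normcM ComplexField.Normc.normcV normc_real ger0_norm ?sqr_ge0//.
  rewrite ler_pdivrMr ?exprn_gt0//; apply: (le_trans (tb k)).
  rewrite mulrCA [leRHS]mulrC ler_wpM2r//; first by rewrite mulr_ge0// invr_ge0.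
  by rewrite lerXn2r// nnegrE ltW.
have a0 : 0 < a n by exact: lt_le_trans ca.
have aC0 : (a n)%:C%C != 0 :> C by rewrite gt_eqF// ltcR.
(* At [X n], [h_n^2] is 1/4 and [g n] is [a n], whence the coefficient. *)
pose G := (4 * t n / (a n)%:C%C) *: g n.
have G1 : ua_norm G <= 1.
  rewrite ua_normZ mulr_ile1 ?ua_norm_ge0// norm_normc -[leRHS]/((1 : R)%:C%C) lecR.
  rewrite !ComplexField.Normc.normcM ComplexField.Normc.normcV normc_real gtr0_norm//.
  have -> : normc (4 : C) = 4.
    by rewrite -(rmorph_nat (real_complex R)) normc_real ger0_norm.
  rewrite ler_pdivrMr// mul1r -ler_pdivlMl//; apply: (le_trans (tb n)).
  rewrite ler_wpM2l ?invr_ge0// (le_trans _ ca)//.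
  rewrite (@le_trans _ _ (c n ^+ 2))//; first by rewrite ler_piMr// sqr_ge0.
  by rewrite expr2 ler_piMr// ltW.
exists ((2^-1 *: (1 - v n)) ^+ 2 * G + (2^-1 *: (1 + v n)) ^+ 2 * F).
split; first exact: peak_combination.
move=> j jN; rewrite charD// !charM// !charZ// !charD// charN// char1//.
(* At [X n] the function [F] vanishes since [n] is not in [s]; at the other points [G] vanishes. *)
rewrite HF// inE; have [->|jn] := eqVneq j n => /=.
  rewrite (negPf ns) vn gn mulr0 addr0 subr0.
  by rewrite mulr1 (divfK aC0); field.
have [jg jv] := odgv n j nN jN jn.
rewrite jg jv !mulr0 add0r; case: ifP => _; last by rewrite mulr0.
have -> : 2^-1 * (1 + (c n)%:C%C) = q%:C%C.
  rewrite /q mulrC (rmorphM (real_complex R)) fmorphV rmorphD rmorph1.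
  by rewrite (rmorph_nat (real_complex R)).
by rewrite -expr2 (rmorphXn (real_complex R)) mulrC divfK// expf_neq0.
Qed.

End Characters.

(** Past some [m] the sums of [1 - r k] stay below 1/2, so by the Weierstrass inequality [tail] the
    later factors multiply to at least 1/2; the first [m] factors are positive. *)
Lemma prod_lower_bound (R : realType) (r : nat -> R) (S : R) :
  (forall k, 0 < r k <= 1) -> (forall N, \sum_(0 <= k < N) (1 - r k) <= S) ->
  exists2 P, 0 < P & forall N, P <= \prod_(0 <= k < N) r k.
Proof.
move=> r01 rS; pose s N := \sum_(0 <= k < N) (1 - r k).
have r0 k : 0 < r k by have /andP[] := r01 k.
have r1 k : r k <= 1 by have /andP[] := r01 k.
have half : 0 < 2^-1 :> R by rewrite invr_gt0.
have [|_ [m _ <-] sm] := @sup_adherent R (range s) 2^-1 half.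
  split; first by exists (s 0%N), 0%N.
  by exists S => _ [N _ <-]; exact: rS.
have sle N : s N <= sup (range s).
  by apply: ub_le_sup; [exists S => _ [? _ <-]; exact: rS|exists N].
have P0 N : 0 < \prod_(0 <= k < N) r k by apply: prodr_gt0.
have tail n : 1 - \sum_(m <= k < m + n) (1 - r k) <= \prod_(m <= k < m + n) r k.
  elim: n => [|n IH]; first by rewrite addn0 !big_geq// subr0.
  rewrite addnS !big_nat_recr ?leq_addr//=.
  set t := \sum_(_ <= _ < _) _ in IH *; set p := \prod_(_ <= _ < _) _ in IH *.
  have p1 : p <= 1 by apply: prodr_ile1 => k _; rewrite ltW/=.
  have := r1 (m + n)%N; have := r0 (m + n)%N; nra.
exists (2^-1 * \prod_(0 <= k < m) r k); first by rewrite mulr_gt0// invr_gt0.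
move=> N; have [Nm|mN] := leqP N m.
  rewrite (big_cat_nat (leq0n N) Nm)//= mulrCA ler_piMr ?(ltW (P0 _))//.
  rewrite mulr_ile1 ?invr_ge0 ?invf_le1 ?ler1n//.
    by apply: prodr_ge0 => k _; rewrite ltW.
  by apply: prodr_ile1 => k _; rewrite ltW/=.
rewrite (big_cat_nat (leq0n m) (ltnW mN))//= mulrC ler_wpM2l ?(ltW (P0 _))//.
have := tail (N - m)%N; rewrite subnKC ?(ltnW mN)//; apply: le_trans.
have := sle N; rewrite /s (big_cat_nat (leq0n m) (ltnW mN))//= -/(s m); lra.
Qed.

(** * Real and imaginary parts, and limits along an ultrafilter *)

Lemma Re_linear (R : realType) (a z w : R[i]) : complex.Re (a * z + w) =
  complex.Re a * complex.Re z - complex.Im a * complex.Im z + complex.Re w.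
Proof. by case: a z w => [? ?] [? ?] [? ?]. Qed.

Lemma Im_linear (R : realType) (a z w : R[i]) : complex.Im (a * z + w) =
  complex.Re a * complex.Im z + complex.Im a * complex.Re z + complex.Im w.
Proof. by case: a z w => [? ?] [? ?] [? ?]. Qed.

Lemma normc_ge_Im (R : realType) (z : R[i]) : `|complex.Im z|%:C%C <= `|z|.
Proof.
by case: z => a b; rewrite normc_def lecR -sqrtr_sqr ler_wsqrtr// lerDr sqr_ge0.
Qed.

Lemma normc_le_ReIm (R : realType) (z : R[i]) :
  `|z| <= (`|complex.Re z| + `|complex.Im z|)%:C%C.
Proof.
rewrite (rmorphD (real_complex R)) {1}[z]complexE (le_trans (ler_normD _ _))//.
by rewrite normrM !norm_normc !normc_real /= expr0n expr1n add0r sqrtr1 mul1r.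
Qed.

(** Compactness of the segment yields a cluster point, and an ultrafilter converges to each of its
    cluster points. *)
Lemma ultra_bounded_cvg (R : realType) (F : set_system nat) (u : nat -> R) (M : R) :
  UltraFilter F -> (forall n, `|u n| <= M) -> exists l : R, u @ F --> l.
Proof.
move=> FU uM; have FP : ProperFilter F by exact: ultra_proper.
have FI : F (u @^-1` [set` `[- M, M]]).
  by apply: (filterS _ (@filterT _ F _)) => n _ /=; rewrite in_itv/= -ler_norml uM.
have [l [_ lc]] := @segment_compact R (- M) M (u @ F) _ FI; exists l => U Ul.
have [//|FC] := in_ultra_setVsetC (u @^-1` U) FU.
by have [y []] := lc (~` U) U FC Ul.
Qed.

(** * Weak-star compactness in the dual space *)

Section Duality.
Variables (R : realType) (A : uniformAlgType R[i]) (X : completeNormedModType R[i]).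
Variables (J : A -> X -> R[i]) (hJ : isometric_dual J).

Lemma dual_scalar (f : A) : scalar (J f).
Proof.
have [_ rJ _] := hJ; have : dual_space (J f) by rewrite -rJ; exists f.
by case.
Qed.

Lemma dual_le (f : A) (w : X) : `|J f w| <= `|f| * `|w|.
Proof.
have [_ rJ nJ] := hJ; have Jf : dual_space (J f) by rewrite -rJ; exists f.
have JZ (a : R[i]) v : J f (a *: v) = a * J f v.
  have [lin _] := Jf; have := lin (-1) 0 0; rewrite scaler0 addr0 mulN1r addNr => J0.
  by have := lin a v 0; rewrite addr0 J0 addr0.
have [->|w0] := eqVneq w 0.
  by have := JZ 0 0; rewrite scaler0 mul0r => ->; rewrite !normr0 mulr0.
have nw0 : 0 < `|w| by rewrite normr_gt0.
rewrite -ler_pdivrMr// nJ.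
have -> : `|J f w| / `|w| = `|J f (`|w|^-1 *: w)|.
  by rewrite JZ normrM normfV normr_id mulrC.
rewrite norm_normc lecR; apply: ub_le_sup.
  by have [M HM] := dual_space_bounded Jf; exists M => _ [v v1 <-]; exact: HM.
by exists (`|w|^-1 *: w) => //=; rewrite normrZ normfV normr_id mulVf// gt_eqF.
Qed.

(** The pointwise limit [L] of the [J (f n)] along an ultrafilter finer than [\oo] is a bounded
    functional, hence of the form [J g]. An ultrafilter replaces subsequences because [X] may be
    non-separable. *)
Lemma weak_star_interpolation (w : nat -> X) (alpha : nat -> R[i]) (M : R) :
  (forall N, exists2 f : A, `|f| <= M%:C%C & forall n, (n < N)%N -> J f (w n) = alpha n) ->
  exists f : A, forall n, J f (w n) = alpha n.
Proof.
move=> H; have /choice[f Hf] N : exists f : A, `|f| <= M%:C%C /\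
    forall n, (n < N)%N -> J f (w n) = alpha n.
  by have [f] := H N; exists f.
have fM N : `|f N| <= M%:C%C by have [] := Hf N.
have fw N n : (n < N)%N -> J (f N) (w n) = alpha n by have [_] := Hf N; exact.
have [linJ rJ _] := hJ.
have M0 : 0 <= M%:C%C :> R[i] by exact: le_trans (normr_ge0 _) (fM 0%N).
have [F [FU FF]] := @ultraFilterLemma _ (\oo : set_system nat) _.
have FP : ProperFilter F by exact: ultra_proper.
pose B (v : X) := complex.Re (M%:C%C * `|v|).
have BE v : M%:C%C * `|v| = (B v)%:C%C.
  by rewrite RRe_real// realM ?normr_real// complex_real.
have Jle n v : `|J (f n) v| <= (B v)%:C%C.
  by rewrite (le_trans (dual_le _ _))// -BE ler_wpM2r.
have /choice[L HL] v : exists l : R[i],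
    (fun n => complex.Re (J (f n) v)) @ F --> complex.Re l /\
    (fun n => complex.Im (J (f n) v)) @ F --> complex.Im l.
  have [n|a Ha] := @ultra_bounded_cvg R F (fun n => complex.Re (J (f n) v)) (B v) FU.
    by rewrite -lecR (le_trans (normc_ge_Re _)).
  have [n|b Hb] := @ultra_bounded_cvg R F (fun n => complex.Im (J (f n) v)) (B v) FU.
    by rewrite -lecR (le_trans (normc_ge_Im _)).
  by exists (Complex a b).
have cl (h : nat -> R) l l' : h @ F --> l -> h @ F --> l' -> l = l' :> R.
  by apply: cvg_unique; exact: Rhausdorff.
have Llin : scalar L.
  move=> a v v'; have [r i] := HL (a *: v + v').
  have [r1 i1] := HL v; have [r2 i2] := HL v'.
  apply/eqP; rewrite eq_complex; apply/andP; split; apply/eqP.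
    apply: (cl _ _ _ r); under eq_fun do rewrite dual_scalar Re_linear.
    by rewrite Re_linear; apply: cvgD r2; apply: cvgB; apply: cvgMr.
  apply: (cl _ _ _ i); under eq_fun do rewrite dual_scalar Im_linear.
  by rewrite Im_linear; apply: cvgD i2; apply: cvgD; apply: cvgMr.
(* The factor 2 comes from bounding real and imaginary parts separately; continuity of [L] is all
   that is sought. *)
have Lle v : `|L v| <= (2 * B v)%:C%C.
  have cle (h : nat -> R) l : h @ F --> l -> (forall n, `|h n| <= B v) -> `|l| <= B v.
    move=> hl hB; apply: (ler_cvg_to (cvg_norm hl) (cvg_cst (B v))).
    exact: nearW.
  have [r i] := HL v.
  rewrite (le_trans (normc_le_ReIm _))// lecR mulr_natl mulr2n lerD//.
    by apply: (cle _ _ r) => n; rewrite -lecR (le_trans (normc_ge_Re _)).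
  by apply: (cle _ _ i) => n; rewrite -lecR (le_trans (normc_ge_Im _)).
have Ldual : dual_space L.
  split=> // v; apply/cvgrPdist_lt => e e0; apply/nbhs_normP.
  (* Adding 1 keeps [K] positive when [M = 0]. *)
  pose K : R[i] := 2 * M%:C%C + 1.
  have K0 : 0 < K by rewrite ltr_wpDl// mulr_ge0.
  exists (e / K); first exact: divr_gt0.
  move=> v'; rewrite /ball_/= ltr_pdivlMr// => vv'.
  have <- : L (v - v') = L v - L v' by rewrite addrC -scaleN1r Llin mulN1r addrC.
  rewrite (le_lt_trans _ vv')// (le_trans (Lle _))//.
  rewrite (rmorphM (real_complex R))/= -BE (rmorph_nat (real_complex R)) mulrA mulrC.
  by rewrite ler_wpM2l// lerDl.
move: Ldual; rewrite -rJ => -[g _ gL]; exists g => n; rewrite gL.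
have [r i] := HL (w n).
have near_n : \forall k \near F, J (f k) (w n) = alpha n.
  by apply: FF; exists n.+1 => // k /= nk; rewrite fw.
apply/eqP; rewrite eq_complex; apply/andP; split; apply/eqP.
  by apply: (cl _ _ _ r); apply: cvg_near_cst; apply: filterS near_n => k ->.
by apply: (cl _ _ _ i); apply: cvg_near_cst; apply: filterS near_n => k ->.
Qed.

End Duality.

(** * Infinite Gleason products and interpolation with a uniform constant *)

Section GleasonProd.
Variables (R : realType) (A : uniformAlgType R[i]) (x : nat -> A -> R[i]).
Hypothesis Hx : forall n, @maximal_ideal_space _ A (x n).
Hypothesis xinj : injective x.
Local Notation rho := (@gleason_dist R A).
Local Notation d := (gleason_prod x).
Let pp n N := \prod_(0 <= k < N | k != n) rho (x n) (x k).

Let rho01 n k : 0 <= rho (x n) (x k) <= 1.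
Proof. by rewrite gleason_dist_ge0// gleason_dist_le1. Qed.

Let pp0 n N : 0 <= pp n N.
Proof. by apply: prodr_ge0 => k _; have /andP[] := rho01 n k. Qed.

Let pp_noninc n : {homo pp n : N M / (N <= M)%N >-> M <= N}.
Proof.
apply/nonincreasing_seqP => N; rewrite /pp big_mkcond [leRHS]big_mkcond/= big_nat_recr//=.
rewrite ler_piMr//; first by rewrite -big_mkcond; exact: pp0.
by case: ifP => // _; have /andP[] := rho01 n N.
Qed.

Let pp_cvg n : cvgn (pp n).
Proof.
by apply: nonincreasing_is_cvgn => //; exists 0 => _ [N _ <-]; exact: pp0.
Qed.

Lemma gleason_prod_le n N : d n <= \prod_(0 <= k < N | k != n) rho (x n) (x k).
Proof. exact: (nonincreasing_cvgn_ge (@pp_noninc n) (@pp_cvg n) N). Qed.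

Lemma gleason_prod_ge n (P : R) :
  (forall N, P <= \prod_(0 <= k < N | k != n) rho (x n) (x k)) -> P <= d n.
Proof. by move=> H; apply: (limr_ge (@pp_cvg n)); exact: nearW. Qed.

Lemma gleason_prod_ge0 n : 0 <= d n.
Proof. by apply: gleason_prod_ge => N; exact: pp0. Qed.

Lemma gleason_prod_le1 n : d n <= 1.
Proof. by have := gleason_prod_le n 0; rewrite big_geq. Qed.

Lemma gleason_prod_le_dist n k : k != n -> d n <= rho (x n) (x k).
Proof.
move=> kn; apply: (le_trans (gleason_prod_le n k.+1)).
rewrite big_mkcond/= big_nat_recr//= kn -big_mkcond/= ler_piMl//.
  by have /andP[] := rho01 n k.
by apply: prodr_ile1 => j _; exact: rho01.
Qed.

(* By symmetry [rho (x n) (x k) >= d k], so the summability of [1 - d] controls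
   the product at every [n], including those where no bound on [d n] is given. *)
Lemma gleason_prod_gt0 (S : R) :
  (forall N, \sum_(0 <= k < N) (1 - d k) <= S) -> forall n, 0 < d n.
Proof.
move=> dS n; pose r k := if k == n then 1 else rho (x n) (x k).
have [k|N|P P0 HP] := @prod_lower_bound R r S.
(* Injectivity of [x] makes every off-diagonal factor positive. *)
- rewrite /r; case: eqVneq => [_|kn]; first by rewrite ltr01 lexx.
  rewrite gleason_dist_le1// andbT gleason_dist_gt0// => /xinj e.
  by rewrite e eqxx in kn.
- apply: le_trans (dS N); apply: ler_sum => k _; rewrite lerD2l lerN2 /r.
  case: eqVneq => [_|kn]; first exact: gleason_prod_le1.
  apply: le_trans (gleason_dist_sym_le (Hx k) (Hx n)).
  by apply: gleason_prod_le_dist; rewrite eq_sym.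
apply: (lt_le_trans P0); apply: gleason_prod_ge => N.
rewrite big_mkcond/=; apply: le_trans (HP N) _.
apply: ler_prod => k _; rewrite /r; case: eqVneq => [_|kn] /=; rewrite lexx andbT//.
by rewrite gleason_dist_ge0.
Qed.

Lemma bounded_interpolation (S : R) :
  (forall N, \sum_(0 <= k < N) (1 - d k) <= S) ->
  exists2 K : R, 0 < K & forall N (t : nat -> R[i]), (forall k, normc (t k) <= K) ->
    exists2 F : ua_ring A, ua_norm F <= 1 & forall j, (j < N)%N -> x j F = t j.
Proof.
move=> dS; have d0 := gleason_prod_gt0 dS.
(* The strict gap below [d n] leaves room for near-extremal functions and truncation; its total cost
   is at most 1, hence the bound [S + 1] below. *)
pose c n := d n * (1 - 2^-1 ^+ n.+1).
have e01 n : 0 < (2^-1 ^+ n.+1 : R) < 1.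
  by rewrite exprn_gt0 ?invr_gt0//= exprn_ilt1// invf_lt1// ltr1n.
have c0 n : 0 < c n by have /andP[_ ?] := e01 n; rewrite mulr_gt0// subr_gt0.
have cd n : c n < d n.
  by have /andP[? _] := e01 n; rewrite gtr_pMr// gtrBl.
have d1 := gleason_prod_le1.
have c1 n : c n <= 1 by exact: le_trans (ltW (cd n)) (d1 n).
have [k|N|P P0 HP] := @prod_lower_bound R c (S + 1).
- by rewrite c0 c1.
- have sum2 : \sum_(0 <= k < N) 2^-1 ^+ k.+1 = 1 - 2^-1 ^+ N :> R.
    elim: (N) => [|m IH]; first by rewrite big_geq// expr0 subrr.
    by rewrite big_nat_recr//= IH exprS; field.
  apply: (@le_trans _ _ (\sum_(0 <= k < N) ((1 - d k) + 2^-1 ^+ k.+1))).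
    apply: ler_sum => k _; have /andP[e0 _] := e01 k; have := d1 k.
    by rewrite /c; move: e0; set e := _ ^+ _; nra.
  rewrite big_split/= lerD// sum2 gerBl exprn_ge0//.
exists (4^-1 * P ^+ 2); first by rewrite mulr_gt0 ?exprn_gt0.
(* [a n < d n] lets [g n] attain [a n] at [x n]; [c n < a n] lets the truncated Blaschke factor send
   [a n] to 0 and 0 to [c n]. *)
move=> N t tK; pose a n := (c n + d n) / 2.
have ca n : c n < a n by rewrite /a; have := cd n; lra.
have ad n : a n < d n by rewrite /a; have := cd n; lra.
have /choice[g Hg] n : exists f : ua_ring A, [/\ ua_norm f <= 1, x n f = (a n)%:C%C &
    forall k, (k < N)%N -> k != n -> x k f = 0].
  have [||f [f1 xf kf]] := @prod_gleason_dist_gt R A x (x n)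
    [seq k <- index_iota 0 N | k != n] (a n) (Hx n) Hx.
  - exact: ltW (lt_trans (c0 n) (ca n)).
  - rewrite big_filter; exact: lt_le_trans (ad n) (gleason_prod_le _ _).
  by exists f; split=> // k kN kn; apply: kf; rewrite mem_filter kn mem_index_iota.
have /choice[v Hv] n : exists f : ua_ring A, [/\ ua_norm f <= 1, x n f = 0 &
    forall k, (k < N)%N -> k != n -> x k f = (c n)%:C%C].
  have [p [p1 p0 pa]] := truncated_blaschke (c0 n) (ca n) (lt_le_trans (ad n) (d1 n)).
  have [g1 gn gk] := Hg n; exists (horner_alg (g n) p); split.
  - exact: von_neumann.
  - by rewrite char_horner// gn.
  - by move=> k kN kn; rewrite char_horner// gk.
have Hc n : [/\ 0 < c n, c n <= a n & c n <= 1] by split=> //; exact: ltW.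
have Hgv n : (n < N)%N -> ua_norm (g n) <= 1 /\ ua_norm (v n) <= 1.
  by have [] := Hg n; have [] := Hv n.
have Hd n : (n < N)%N -> x n (g n) = (a n)%:C%C /\ x n (v n) = 0.
  by have [] := Hg n; have [] := Hv n.
have Ho n j : (n < N)%N -> (j < N)%N -> j != n ->
    x j (g n) = 0 /\ x j (v n) = (c n)%:C%C.
  by move=> nN jN jn; have [_ _ gk] := Hg n; have [_ _ vk] := Hv n; rewrite gk ?vk.
have [||k|F [F1 HF]] := finite_interpolation Hx Hc Hgv Hd Ho (s := index_iota 0 N) (t := t).
- exact: iota_uniq.
- by apply/allP => k; rewrite mem_index_iota.
- rewrite (le_trans (tK k))// ler_wpM2l ?invr_ge0// prodrXl lerXn2r// ?nnegrE ?(ltW P0)//.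
  by rewrite ltW// prodr_gt0.
by exists F => // j jN; rewrite HF// mem_index_iota jN.
Qed.

End GleasonProd.

(** * From finitely many points to the whole sequence *)

Theorem theorem1p1 (R : realType)
    (A : uniformAlgType R[i]) (X : completeNormedModType R[i])
    (J : A -> X -> R[i]) (hJ : isometric_dual J)
    (x : nat -> A -> R[i])
    (hx : forall n : nat,
       (@maximal_ideal_space R[i] A `&` canonical_image J) (x n))
    (hinj : injective x)
    (hsum : (\sum_(0 <= n <oo)
       ((1 - gleason_prod x n) `^ (3%:R^-1))%:E < +oo)%E) :
  interpolating x.
Proof.
have Hx n : @maximal_ideal_space _ A (x n) by have [] := hx n.
have /choice[w Hw] n : exists v : X, x n = (fun f : A => J f v).
  by have [_ [v _ <-]] := hx n; exists v.
have d1 := gleason_prod_le1 Hx; have d0 := gleason_prod_ge0 Hx.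
have [S dS] : exists S, forall N, \sum_(0 <= k < N) (1 - gleason_prod x k) <= S.
  set T := (X in (X < _)%E) in hsum.
  have T0 N : ((\sum_(0 <= n < N) (1 - gleason_prod x n))%:E <= T)%E.
    have pw_ge0 n : (0 <= ((1 - gleason_prod x n) `^ (3%:R^-1))%:E)%E.
      by rewrite lee_fin powR_ge0.
    apply: le_trans (nneseries_lim_ge N (fun n _ _ => pw_ge0 n)).
    rewrite sumEFin lee_fin; apply: ler_sum => k _.
    (* On [[0, 1]] a number is at most its cube root; zero is treated apart since [ger1_powR] asks
       for a positive base. *)
    have [->|dk] := eqVneq (1 - gleason_prod x k) 0; first exact: powR_ge0.
    apply: ger1_powR; last by rewrite invf_le1// ler1n.
    by rewrite lt_def dk subr_ge0 d1 gerBl d0.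
  exists (fine T) => N; have := T0 N; case: (T) hsum (T0 0%N) => //= _.
move=> al [M HM].
have [K K0 HK] := bounded_interpolation Hx hinj dS.
(* The maximum with 1 makes the scaling factor [s] below nonzero. *)
pose M' := Num.max M 1.
have M'0 : 0 < M' by rewrite lt_max ltr01 orbT.
have [N|f Hf] := @weak_star_interpolation R A X J hJ w al (M' / K); last first.
  by exists f => n; rewrite Hw Hf.
(* Dividing the targets by [s] brings them below [K]; multiplying the solution by [s] gives norm at
   most [M' / K], whatever [N] is. *)
pose s : R[i] := (M' / K)%:C%C.
have s0 : s != 0 by rewrite gt_eqF// ltcR divr_gt0.
have [k|F F1 HF] := HK N (fun k => al k / s).
  rewrite ComplexField.Normc.normcM ComplexField.Normc.normcV normc_real gtr0_norm ?divr_gt0//.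
  rewrite ler_pdivrMr ?divr_gt0// mulrCA divff ?gt_eqF// mulr1.
  by rewrite (le_trans (HM k))// le_max lexx.
exists (s *: F : ua_ring A).
  have : ua_norm (s *: F) <= s by rewrite ua_normZ ger0_norm ?ler_piMr// lecR divr_ge0// ltW.
  exact.
move=> n nN; have := Hw n => /(congr1 (fun h => h (s *: F : ua_ring A))) <-.
by rewrite charZ// HF// mulrC divfK.
Qed.
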